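(* Let $d$ be a degree sequence and let $n\ge 4$. If $R_1,\dots,R_n$ are the (distinct) vertices of a clique in the realization graph $\mathcal{G}(d)$, then a dial $(W,P)$ exists with respect to $\{R_1,\dots,R_n\}$. Moreover, for all distinct $i,j\in\{1,\dots,n\}$, the dial configuration in $R_i$ (the vertex set $W$ together with the edges and non-edges of $R_i$ among the pairs in $P$) contains an alternating 4-cycle on which a 2-switch converts $R_i$ into $R_j$.
   Context: All graphs are finite and simple. A labeled realization of a degree sequence $d=(d_1,\dots,d_n)$ is a graph on the fixed vertex set $\{v_1,\dots,v_n\}$ in which $v_i$ has degree $d_i$. An alternating 4-cycle $[u,v:w,x]$ in a graph $H$ consists of four distinct vertices $u,v,w,x$ with $uv,wx\in E(H)$ and $ux,vw\notin E(H)$ (nothing is required of the pairs $\{u,w\},\{v,x\}$). A 2-switch on it deletes $uv,wx$ and adds $ux,vw$. The realization graph $\mathcal{G}(d)$ has the labeled realizations of $d$ as vertices, two being adjacent when one is obtained from the other by a single 2-switch. Dial: given a set $\mathcal{S}=\{R_1,\dots,R_n\}$ of labeled realizations of the same degree sequence on a common vertex set $V$, a dial with respect to $\mathcal{S}$ is a pair $(W,P)$ such that: (a) $P$ is the set of all pairs $\{a,b\}\subseteq V$ that are an edge in some $R_i$ and a non-edge in some $R_j$, and $W$ is the union of the pairs in $P$; (b) there are two vertices $u,v\in W$ such that $P$ consists exactly of the pairs $\{u,w\}$ and $\{v,w\}$ for $w\in W\setminus\{u,v\}$; (c) in every $R_i$, $u$ is adjacent to exactly one vertex $w_i$ of $W\setminus\{u,v\}$,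 and $v$ is non-adjacent to $w_i$ but adjacent to every vertex of $W\setminus\{u,v,w_i\}$. *)

(* Defs.v *)
From HB Require Import structures.
From mathcomp Require Import all_boot.

Set Implicit Arguments.
Unset Strict Implicit.
Unset Printing Implicit Defensive.

(* A finite simple graph on the vertex type T is given by its edge set, a set
   of 2-element subsets of T. *)
Definition simple_graph (T : finType) (H : {set {set T}}) : bool :=
  [forall e in H, #|e| == 2].

Definition adjacent (T : finType) (H : {set {set T}}) (a b : T) : bool :=
  [set a; b] \in H.

Definition degree (T : finType) (H : {set {set T}}) (a : T) : nat :=
  #|[set b | adjacent H a b]|.

Definition realizes (m : nat) (d : m.-tuple nat) (H : {set {set 'I_m}}) : bool :=
  simple_graph H && [forall i : 'I_m, degree H i == tnth d i].

Record realization (m : nat) (d : m.-tuple nat) := Realization {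
  edges :> {set {set 'I_m}};
  edges_realizes : realizes d edges
}.

HB.instance Definition _ (m : nat) (d : m.-tuple nat) :=
  [isSub for @edges m d].
HB.instance Definition _ (m : nat) (d : m.-tuple nat) :=
  [Finite of realization d by <:].

Definition alt4 (T : finType) (H : {set {set T}}) (u v w x : T) : bool :=
  [&& uniq [:: u; v; w; x],
      adjacent H u v, adjacent H w x, ~~ adjacent H u x & ~~ adjacent H v w].

Definition switch (T : finType) (H : {set {set T}}) (u v w x : T) :
    {set {set T}} :=
  (H :\: [set [set u; v]; [set w; x]]) :|: [set [set u; x]; [set v; w]].

Definition switch_to (T : finType) (H K : {set {set T}}) : bool :=
  [exists u : T, exists v : T, exists w : T, exists x : T,
    alt4 H u v w x && (K == switch H u v w x)].

(* Adjacency relation of the realization graph of d. *)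
Definition realization_graph (m : nat) (d : m.-tuple nat) :
    rel (realization d) :=
  fun R R' => switch_to R R' || switch_to R' R.

Definition clique (T : finType) (e : rel T) (A : {set T}) : Prop :=
  {in A &, forall x y : T, x != y -> e x y}.

Definition varying_pairs (m : nat) (d : m.-tuple nat)
    (S : {set realization d}) : {set {set 'I_m}} :=
  [set e : {set 'I_m} | [&& #|e| == 2,
     [exists R in S, e \in edges R] & [exists R in S, e \notin edges R]]].

Definition dial (m : nat) (d : m.-tuple nat) (S : {set realization d})
    (W : {set 'I_m}) (P : {set {set 'I_m}}) : Prop :=
  [/\ P = varying_pairs S,
      W = cover P
    & exists u v : 'I_m, let W' := W :\: [set u; v] in
      [/\ u \in W, v \in W, u != v,
          P = [set [set u; w] | w in W'] :|: [set [set v; w] | w in W']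
        & {in S, forall R : realization d, exists w : 'I_m,
            [/\ w \in W', adjacent R u w,
                {in W' :\ w, forall y, ~~ adjacent R u y},
                ~~ adjacent R v w
              & {in W' :\ w, forall y, adjacent R v y}]}]].

(* The dial configuration in H has vertex set W, edges P :&: H and non-edges
   P :\: H; the pairs outside P carry no information in it. *)
Definition dial_alt4 (T : finType) (W : {set T}) (P H : {set {set T}})
    (u v w x : T) : bool :=
  [&& uniq [:: u; v; w; x],
      [set u; v; w; x] \subset W,
      [set u; v] \in P :&: H, [set w; x] \in P :&: H,
      [set u; x] \in P :\: H & [set v; w] \in P :\: H].

(* Main.v *)
Require Import Defs.
From mathcomp Require Import all_boot.

(** Adjacent realizations differ by an alternating 4-cycle: one perfect matching
    of a 4-set is removed and another one is added. Fix a member [H] of the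
    clique. Any two other members [K], [K'] are adjacent, so the 4-cycles
    [H] to [K] and [H] to [K'] share exactly two pairs. If these were both
    removed (or, complementing, both added), then [H], [K], [K'] would carry the
    three perfect matchings of one 4-set, which leaves no room for a fourth
    member. So one removed and one added pair are shared; they meet, and the
    cycles are [a b c d] and [a b c d'] for some path [a b c]. Comparing a third
    cycle with these two shows that it contains the same path. Hence [a] and [c]
    are the poles of the dial, with [b] the neighbour of [a] in [H]. *)

Set Implicit Arguments.
Unset Strict Implicit.
Unset Printing Implicit Defensive.

(** * Alternating 4-cycles as pairs of set differences *)

Section AlternatingDifference.

Variable T : finType.
Implicit Types (H K : {set {set T}}) (a b c d : T).

(* [H] becomes [K] by the 2-switch on the alternating 4-cycle [a, b : c, d]. *)
Definition alt_diff H K a b c d : Prop :=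
  [/\ uniq [:: a; b; c; d],
      H :\: K = [set [set a; b]; [set c; d]]
    & K :\: H = [set [set a; d]; [set b; c]]].

Lemma eq_set2 a b c d :
  [set a; b] = [set c; d] -> (a = c /\ b = d) \/ (a = d /\ b = c).
Proof.
move=> E.
have : a \in [set c; d] by rewrite -E set21.
have : b \in [set c; d] by rewrite -E set22.
have : c \in [set a; b] by rewrite E set21.
have : d \in [set a; b] by rewrite E set22.
by do 4![case/set2P=> ?]; subst; auto.
Qed.

Lemma cards2_neq (U : finType) (x y : U) : x != y -> #|[set x; y]| = 2.
Proof. by move=> n; rewrite cards2 n. Qed.

Lemma uniq4 a b c d :
  uniq [:: a; b; c; d] =
  [&& a != b, a != c, a != d, b != c, b != d & c != d].
Proof. by rewrite /= !inE !negb_or !andbT -!andbA. Qed.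

Lemma matching_neq a b c d :
  uniq [:: a; b; c; d] -> [set a; b] != [set c; d].
Proof.
rewrite uniq4 => /and5P[_ nac nad _ _]; apply/eqP=> /eq_set2.
by case=> [[e _]|[e _]]; rewrite e eqxx in nac nad.
Qed.

Lemma matching_disjoint a b c d (e f : {set T}) x :
    uniq [:: a; b; c; d] ->
    e \in [set [set a; b]; [set c; d]] -> f \in [set [set a; b]; [set c; d]] ->
  x \in e -> x \in f -> e = f.
Proof.
rewrite uniq4 => /and5P[_ nac nad nbc /andP[nbd _]].
by do 2![case/set2P=> ->] => //; do 2![case/set2P=> ?]; subst;
  rewrite ?eqxx in nac nad nbc nbd.
Qed.

Lemma alt_diff_rot2 H K a b c d : alt_diff H K a b c d -> alt_diff H K c d a b.
Proof.
rewrite /alt_diff !uniq4 => -[u -> ->]; split; last 2 first.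
- by rewrite setUC.
- by rewrite setUC [[set c; b]]setUC [[set d; a]]setUC.
by case/and5P: u => ? ? ? ? /andP[? ?]; do !(apply/andP; split) => //; rewrite eq_sym.
Qed.

Lemma alt_diff_flip H K a b c d : alt_diff H K a b c d -> alt_diff H K b a d c.
Proof.
rewrite /alt_diff !uniq4 => -[u -> ->]; split; last 2 first.
- by rewrite [[set b; a]]setUC [[set d; c]]setUC.
- by rewrite setUC.
by case/and5P: u => ? ? ? ? /andP[? ?]; do !(apply/andP; split) => //; rewrite eq_sym.
Qed.

Lemma alt_diff_sym H K a b c d : alt_diff H K a b c d -> alt_diff K H a d c b.
Proof.
rewrite /alt_diff !uniq4 => -[u -> ->]; split; last 2 first.
- by rewrite [[set c; b]]setUC.
- by rewrite [[set d; c]]setUC.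
by case/and5P: u => ? ? ? ? /andP[? ?]; do !(apply/andP; split) => //; rewrite eq_sym.
Qed.

Lemma setCD_C H K : ~: H :\: ~: K = K :\: H.
Proof. by rewrite setDE setCK setIC -setDE. Qed.

(** Complementing the graphs exchanges removed and added pairs, so each result on removed pairs also
    yields one on added pairs. *)
Lemma alt_diff_compl H K a b c d :
  alt_diff H K a b c d -> alt_diff (~: H) (~: K) a d c b.
Proof. by move/alt_diff_sym; rewrite /alt_diff !setCD_C. Qed.

(** By the symmetries of the 4-cycle, any removed edge, in either orientation, can play the part of
    the first one. *)
Lemma alt_diff_edge H K p q r s a b :
    alt_diff H K p q r s -> [set a; b] \in H :\: K ->
  exists c d, alt_diff H K a b c d.
Proof.
move=> D; have [_ -> _] := D; case/set2P=> /eq_set2[] [-> ->].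
- by exists r, s.
- by exists s, r; apply: alt_diff_flip.
- by exists p, q; apply: alt_diff_rot2.
by exists q, p; apply/alt_diff_flip/alt_diff_rot2.
Qed.

(** * Comparison of 2-switches that leave the same graph *)

Lemma setD_inj H K K' : H :\: K = H :\: K' -> K :\: H = K' :\: H -> K = K'.
Proof.
move=> /setP E /setP F; apply/setP=> e; move: (E e) (F e); rewrite !inE.
by case: (e \in H); case: (e \in K); case: (e \in K').
Qed.

Lemma alt_diff_card H K a b c d :
  alt_diff H K a b c d -> #|H :\: K| = 2 /\ #|K :\: H| = 2.
Proof.
move=> D; split; first by case: D => u -> _; apply/cards2_neq/matching_neq.
by case/alt_diff_sym: D => u -> _; apply/cards2_neq/matching_neq.
Qed.

Lemma card2_setI_eq (X Y : {set {set T}}) :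
  #|X| = 2 -> #|Y| = 2 -> #|X :&: Y| = 2 -> X = Y.
Proof.
move=> cX cY cI; have /eqP <- : X :&: Y == X.
  by rewrite eqEcard subsetIl cX cI.
by apply/eqP; rewrite eqEcard subsetIr cY cI.
Qed.

(** [K :\: K'] consists of the pairs removed only towards [K'] and those added only towards [K].
    With [x] removed and [y] added pairs in common, its size is [(2 - x) + (2 - y)]; as this is 2,
    [x + y = 2]. *)
Lemma alt_diff_share H K K' a b c d a' b' c' d' p q r s :
    alt_diff H K a b c d -> alt_diff H K' a' b' c' d' ->
    alt_diff K K' p q r s ->
  [\/ H :\: K = H :\: K', K :\: H = K' :\: H
    | (exists e, e \in (H :\: K) :&: (H :\: K')) /\
      (exists e, e \in (K :\: H) :&: (K' :\: H))].
Proof.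
move=> /alt_diff_card[c1 c2] /alt_diff_card[c3 c4] /alt_diff_card[c5 _].
have E : K :\: K' =
    ((H :\: K') :\: (H :\: K)) :|: ((K :\: H) :\: (K' :\: H)).
  by apply/setP=> e; rewrite !inE;
    case: (e \in H); case: (e \in K); case: (e \in K').
have F : ((H :\: K') :\: (H :\: K)) :&: ((K :\: H) :\: (K' :\: H)) = set0.
  by apply/setP=> e; rewrite !inE;
    case: (e \in H); case: (e \in K); case: (e \in K').
move: c5; rewrite E cardsU F cards0 subn0.
rewrite (cardsD (H :\: K')) (cardsD (K :\: H)) c3 c2.
have lA : #|(H :\: K') :&: (H :\: K)| <= 2 by rewrite -c3 subset_leq_card ?subsetIl.
have lB : #|(K :\: H) :&: (K' :\: H)| <= 2 by rewrite -c2 subset_leq_card ?subsetIl.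
have [A0|] := posnP #|(H :\: K') :&: (H :\: K)|.
  rewrite A0; move: lB.
  case E2: #|(K :\: H) :&: (K' :\: H)| => [|[|[|k]]] // _ _.
  by constructor 2; apply: card2_setI_eq.
have [B0|] := posnP #|(K :\: H) :&: (K' :\: H)|.
  rewrite B0; move: lA.
  case E2: #|(H :\: K') :&: (H :\: K)| => [|[|[|k]]] // _ _.
  by constructor 1; apply/esym/card2_setI_eq.
rewrite !card_gt0 => /set0Pn B /set0Pn A _.
by constructor 3; split=> //; rewrite setIC.
Qed.

(** A 4-set has three perfect matchings; once one is removed, only two remain that can be added. *)
Lemma eq_removed H K K' a b c d p q r s :
    alt_diff H K a b c d -> alt_diff H K' p q r s -> H :\: K = H :\: K' ->
  K = K' \/ K' :\: H = [set [set a; c]; [set b; d]].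
Proof.
move=> D D' E; have [u A B] := D.
have [||c' [d' D2]] := @alt_diff_edge H K' p q r s a b => //.
  by rewrite -E A set21.
have [u' A' B'] := D2.
have /set2P[/esym F|/esym F] : [set c; d] \in [set [set a; b]; [set c'; d']].
- by rewrite -A' -E A set22.
- by have := matching_neq u; rewrite F eqxx.
case/eq_set2: F => [[? ?]|[? ?]]; subst c' d'.
  by left; apply: (@setD_inj H); rewrite // B B'.
by right.
Qed.

(* If K and K' remove the same perfect matching of a 4-set, the two graphs add
   the two other matchings, and no fourth graph can be adjacent to all three. *)
Lemma removed_neq H K K' K'' a b c d a' b' c' d' a'' b'' c'' d''
    p q r s p' q' r' s' :
    alt_diff H K a b c d -> alt_diff H K' a' b' c' d' ->
    alt_diff H K'' a'' b'' c'' d'' ->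
    alt_diff K K'' p q r s -> alt_diff K' K'' p' q' r' s' ->
    K != K' -> K != K'' -> K' != K'' ->
  H :\: K <> H :\: K'.
Proof.
move=> D D' D'' D1 D2 n1 n2 n3 E.
have [u _ B] := D.
have [?|Q] := eq_removed D D' E; first by subst K'; rewrite eqxx in n1.
(* Since [K''] differs from [K], it would add the same third matching as [K']. *)
have nA : H :\: K <> H :\: K''.
  move=> E2; have [?|Q2] := eq_removed D D'' E2.
    by subst K''; rewrite eqxx in n2.
  by case/eqP: n3; apply: (@setD_inj H); rewrite -?E -?E2 // Q Q2.
(* By complements, [K''] would remove the matching that [K'] adds, which lies outside [H]. *)
have nB : K :\: H <> K'' :\: H.
  move=> E2; have := eq_removed (alt_diff_compl D) (alt_diff_compl D'').
  rewrite !setCD_C => /(_ E2)[/setC_inj ?|Q2].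
    by subst K''; rewrite eqxx in n2.
  have : [set a; c] \in K' :\: H by rewrite Q set21.
  have : [set a; c] \in H :\: K'' by rewrite Q2 set21.
  by rewrite !inE => /andP[_ ->].
have [E3|E3|[_ [e /setIP[e1 e2]]]] := alt_diff_share D D'' D1 => //.
have [E4|E4|[_ [f /setIP[f1 f2]]]] := alt_diff_share D' D'' D2.
- by apply: nA; rewrite E.
- have := eq_removed (alt_diff_compl D') (alt_diff_compl D'').
  rewrite !setCD_C => /(_ E4)[/setC_inj ?|Q2].
    by subst K''; rewrite eqxx in n3.
  (* Here [K''] would remove the third matching of the 4-set, the one that [K] adds. *)
  have F : [set [set a'; c']; [set d'; b']] = K :\: H.
    have [?|-> //] := eq_removed D' D (esym E).
      by subst K'; rewrite eqxx in n1.
    by rewrite [[set d'; b']]setUC.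
  have : [set a; d] \in H :\: K'' by rewrite Q2 F B set21.
  have : [set a; d] \in K :\: H by rewrite B set21.
  by rewrite !inE => /andP[/negbTE-> _]; rewrite andbF.
rewrite B in e1; rewrite Q in f1.
(* [e] and [f] come from different perfect matchings of one 4-set, so they meet; both are added by
   [K''], so they coincide, which is absurd. *)
have [x xe xf] : exists2 x, x \in e & x \in f.
  case/set2P: e1 => ->; case/set2P: f1 => ->.
  - by exists a; rewrite !inE eqxx.
  - by exists d; rewrite !inE eqxx ?orbT.
  - by exists c; rewrite !inE eqxx ?orbT.
  - by exists b; rewrite !inE eqxx ?orbT.
have [u'' A'' _] := alt_diff_sym D''.
rewrite A'' in e2 f2; have ef := matching_disjoint u'' e2 f2 xe xf; subst f.
move: u; rewrite uniq4 => /and5P[n4 n5 n6 n7 /andP[n8 n9]].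
by case/set2P: e1 f1 => -> /set2P[] /eq_set2[] [? ?]; subst;
  rewrite ?eqxx in n4 n5 n6 n7 n8 n9.
Qed.

(** A removed and an added pair are consecutive sides of the 4-cycle, so [e] and [f] form a path,
    and only the fourth vertex stays free. *)
Lemma alt_diff_common H K K' a b c d a' b' c' d' e f :
    alt_diff H K a b c d -> alt_diff H K' a' b' c' d' ->
    e \in (H :\: K) :&: (H :\: K') -> f \in (K :\: H) :&: (K' :\: H) ->
  exists x y z w w', alt_diff H K x y z w /\ alt_diff H K' x y z w'.
Proof.
move=> D D' /setIP[eK eK'] fKK'.
have [x [y Ee]] : exists x y, e = [set x; y].
  by case: D eK => _ -> _ /set2P[]->; [exists a, b | exists c, d].
subst e; have [z [w {}D]] := alt_diff_edge D eK.
have [z' [w' {}D']] := alt_diff_edge D' eK'.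
have [u _ B] := D; have [u' _ B'] := D'.
move: u u' fKK'; rewrite !uniq4 B B' => /and5P[n1 n2 n3 n4 /andP[n5 n6]].
case/and5P=> n1' n2' n3' n4' /andP[n5' n6'].
case/setIP=> /set2P[]-> /set2P[] /eq_set2[] [? ?]; subst;
  rewrite ?eqxx in n1 n2 n3 n4 n5 n6 n1' n2' n3' n4' n5' n6' => //.
(* The shared added pair contains [x]; flipping the cycles makes [x] the middle of the path. *)
- by exists y, x, w', z, z'; split; apply: alt_diff_flip.
- by exists x, y, z', w, w'.
Qed.

(** If the third cycle missed [{a, b}], it would remove both [{c, d}] and [{c, d'}], which meet in
    [c], although its removed pairs are disjoint. Likewise, missing [{b, c}] would make it add both
    [{a, d}] and [{a, d'}]. *)
Lemma alt_diff_extend H K K' K'' a b c d d' p q r s e f e' f' :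
    alt_diff H K a b c d -> alt_diff H K' a b c d' ->
    alt_diff H K'' p q r s -> d != d' ->
    e \in (H :\: K) :&: (H :\: K'') -> f \in (K :\: H) :&: (K'' :\: H) ->
    e' \in (H :\: K') :&: (H :\: K'') -> f' \in (K' :\: H) :&: (K'' :\: H) ->
  exists z, alt_diff H K'' a b c z.
Proof.
move=> D D' D'' nd /setIP[e1 e2] /setIP[f1 f2] /setIP[e1' e2'] /setIP[f1' f2'].
have [u A B] := D; have [u' A' B'] := D'; have [u'' A'' _] := D''.
have abK : [set a; b] \in H :\: K''.
  move: e1 e1'; rewrite A A' => /set2P[] E; first by rewrite -E.
  case/set2P=> E'; first by rewrite -E'.
  rewrite A'' in e2 e2'; subst e e'.
  have := matching_disjoint u'' e2 e2' (set21 _ _) (set21 _ _).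
  by case/eq_set2=> [[_ E]|[? ?]]; [rewrite E eqxx in nd | subst; rewrite eqxx in nd].
have [r' [s' {}D'']] := alt_diff_edge D'' abK.
have [v _ C] := D''; exists s'.
suff -> : c = r' by [].
move: u u' v f1 f2 f1' f2'; rewrite !uniq4 B B' C.
case/and5P=> n1 n2 n3 n4 /andP[n5 n6] /and5P[m1 m2 m3 m4 /andP[m5 m6]].
case/and5P=> k1 k2 k3 k4 /andP[k5 k6].
case/set2P=> -> /set2P[] /eq_set2[] [? ?]; subst => //;
  rewrite ?eqxx in n1 n2 n3 n4 n5 n6 m1 m2 m3 m4 m5 m6 k1 k2 k3 k4 k5 k6 => //.
case/set2P=> -> /set2P[] /eq_set2[] [? ?]; subst => //;
  by rewrite ?eqxx in nd n1 n2 n3 n4 n5 n6 m1 m2 m3 m4 m5 m6 k1 k2 k3 k4 k5 k6.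
Qed.

(** The changes at [{a, b}] and [{b, c}] cancel, and [d] takes in [K] the place of [b] in [H]. So
    the poles [a] and [c] survive a change of base graph. *)
Lemma alt_diff_base H K K' a b c d d' :
    alt_diff H K a b c d -> alt_diff H K' a b c d' -> d != d' ->
  alt_diff K K' a d c d'.
Proof.
move=> [u A B] [u' A' B'] nd.
have E (G G' : {set {set T}}) : G :\: G' =
    ((H :\: G') :\: (H :\: G)) :|: ((G :\: H) :\: (G' :\: H)).
  by apply/setP=> e; rewrite !inE;
    case: (e \in H); case: (e \in G); case: (e \in G').
have xy (x y y' : T) : y != y' -> [set x; y] != [set x; y'].
  by move=> n; apply/eqP=> /eq_set2[[_ E1]|[? ?]]; subst; rewrite ?E1 eqxx in n.
move: (u) (u'); rewrite !uniq4 => /and5P[n1 n2 n3 n4 /andP[n5 n6]].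
case/and5P=> m1 m2 m3 m4 /andP[m5 m6].
(* Exchanging [y] and [y'] gives the reverse difference, so one computation serves both. *)
have F (y y' : T) : uniq [:: a; b; c; y] -> uniq [:: a; b; c; y'] -> y != y' ->
    ([set [set a; b]; [set c; y']] :\: [set [set a; b]; [set c; y]]) :|:
    ([set [set a; y]; [set b; c]] :\: [set [set a; y']; [set b; c]]) =
    [set [set a; y]; [set c; y']].
  move=> v v' n.
  have h1 : [set a; b] != [set c; y'] := matching_neq v'.
  have h2 : [set a; y] != [set b; c].
    move: v; rewrite uniq4 => /and5P[k1 k2 _ _ _].
    by apply/eqP=> /eq_set2[[E1 _]|[E1 _]]; rewrite E1 eqxx in k1 k2.
  have h3 := xy c _ _ n; have h4 := xy a _ _ n.
  apply/setP=> e; rewrite !inE.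
  case: (eqVneq e [set a; b]) => [->|_].
    have h5 : [set a; b] != [set a; y].
      by apply: xy; move: v; rewrite uniq4 => /and5P[_ _ _ _ /andP[]].
    have h6 : [set a; b] != [set b; c] by rewrite [[set a; b]]setUC xy.
    by rewrite (negbTE h1) (negbTE h5) (negbTE h6) andbF.
  case: (eqVneq e [set c; y']) => [->|_].
    by rewrite [_ == [set c; y]]eq_sym (negbTE h3) !orbT.
  case: (eqVneq e [set a; y]) => [->|_].
    by rewrite (negbTE h4) (negbTE h2) andbF.
  by case: (e == [set b; c]); rewrite ?orbT ?andbF.
split.
- by rewrite uniq4 n2 n3 m3 m6 nd eq_sym n6.
- by rewrite E A A' B B' F.
- by rewrite E A A' B B' F 1?eq_sym // [[set d; c]]setUC.
Qed.

Lemma alt_diff_neq H K a b c d : alt_diff H K a b c d -> H != K.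
Proof.
by case/alt_diff_card=> c1 _; apply/eqP=> E; rewrite E setDv cards0 in c1.
Qed.

(** * From 2-switches to set differences and back *)

Lemma alt_diff_switch H K a b c d :
  alt_diff H K a b c d -> K = switch H a b c d.
Proof.
case=> _ E F; rewrite /switch -E -F; apply/setP=> e; rewrite !inE.
by case: (e \in H); case: (e \in K).
Qed.

Lemma alt4_switch_diff H a b c d :
  alt4 H a b c d -> alt_diff H (switch H a b c d) a b c d.
Proof.
rewrite /alt4 /adjacent => /and5P[u h1 h2 h3 h4].
split=> //; apply/setP=> e; rewrite !inE.
- case: (eqVneq e [set a; b]) => [->|_] /=.
    rewrite h1 /= andbT; apply/norP; split; apply/eqP=> E.
      by rewrite -E h1 in h3.
    by rewrite -E h1 in h4.
  case: (eqVneq e [set c; d]) => [->|_] /=.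
    rewrite h2 /= andbT; apply/norP; split; apply/eqP=> E.
      by rewrite -E h2 in h3.
    by rewrite -E h2 in h4.
  by rewrite andbC; case: (e \in H).
- case: (eqVneq e [set a; d]) => [->|_] /=; first by rewrite (negbTE h3) orbT.
  case: (eqVneq e [set b; c]) => [->|_] /=; first by rewrite (negbTE h4) orbT.
  by case: (e \in H); rewrite ?andbF.
Qed.

Lemma switch_to_alt_diff H K :
  switch_to H K || switch_to K H -> exists a b c d, alt_diff H K a b c d.
Proof.
case/orP=> /existsP[a] /existsP[b] /existsP[c] /existsP[d] /andP[h /eqP->].
  by exists a, b, c, d; apply: alt4_switch_diff.
by exists a, d, c, b; apply/alt_diff_sym/alt4_switch_diff.
Qed.

(** * Cliques with at least four members *)

Section Family.

Variables (n : nat) (G : 'I_n -> {set {set T}}).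
Hypothesis n_ge4 : 4 <= n.
Hypothesis G_switch :
  forall i j, i != j -> exists a b c d, alt_diff (G i) (G j) a b c d.

Lemma exists_fourth (i j k : 'I_n) : exists l, [&& l != i, l != j & l != k].
Proof.
have : 0 < #|~: [set i; j; k]|.
  rewrite cardsCs setCK card_ord subn_gt0 (leq_trans _ n_ge4) // ltnS.
  by rewrite setUC cardsU1 cards2; case: (i != j); case: (_ \notin _).
by rewrite card_gt0 => /set0Pn[l]; rewrite !inE !negb_or -andbA; exists l.
Qed.

(** A fourth member [l] excludes equal removed sets through [removed_neq], and equal added sets
    through the same lemma for the complements. *)
Lemma clique_common (i j k : 'I_n) :
    i != j -> i != k -> j != k ->
  (exists e, e \in (G i :\: G j) :&: (G i :\: G k)) /\
  (exists e, e \in (G j :\: G i) :&: (G k :\: G i)).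
Proof.
move=> ij ik jk; have [l /and3P[li lj lk]] := exists_fourth i j k.
rewrite ![l == _]eq_sym in li lj lk.
have [? [? [? [? Dij]]]] := G_switch ij; have [? [? [? [? Dik]]]] := G_switch ik.
have [? [? [? [? Djk]]]] := G_switch jk; have [? [? [? [? Dil]]]] := G_switch li.
have [? [? [? [? Djl]]]] := G_switch lj; have [? [? [? [? Dkl]]]] := G_switch lk.
have [E|E|//] := alt_diff_share Dij Dik Djk.
  by case: (removed_neq Dij Dik Dil Djl Dkl (alt_diff_neq Djk)
              (alt_diff_neq Djl) (alt_diff_neq Dkl) E).
have := removed_neq (alt_diff_compl Dij) (alt_diff_compl Dik)
  (alt_diff_compl Dil) (alt_diff_compl Djl) (alt_diff_compl Dkl)
  (alt_diff_neq (alt_diff_compl Djk)) (alt_diff_neq (alt_diff_compl Djl))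
  (alt_diff_neq (alt_diff_compl Dkl)).
by rewrite !setCD_C.
Qed.

Lemma clique_poles :
  exists (u v : T) (w : 'I_n -> T),
    forall i j, i != j -> alt_diff (G i) (G j) u (w i) v (w j).
Proof.
have i0 : 'I_n := Ordinal (leq_trans (isT : 0 < 4) n_ge4).
have [i1 /and3P[i10 _ _]] := exists_fourth i0 i0 i0.
have [i2 /and3P[i20 i21 _]] := exists_fourth i0 i1 i1.
rewrite eq_sym in i10; rewrite eq_sym in i20; rewrite eq_sym in i21.
have [? [? [? [? D1]]]] := G_switch i10; have [? [? [? [? D2]]]] := G_switch i20.
have [[e eP] [f fP]] := clique_common i10 i20 i21.
have [u [b [v [d [d' [{}D1 {}D2]]]]]] := alt_diff_common D1 D2 eP fP.
have ndd : d != d'.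
  apply/eqP=> E; subst d'; have [? [? [? [? D12]]]] := G_switch i21.
  case/eqP: (alt_diff_neq D12); case: D1 => _ A B; case: D2 => _ A' B'.
  by apply: (@setD_inj (G i0)); rewrite ?A ?A' ?B ?B'.
(* [w j] will be the varying neighbour of [u] in [G j]; for the base [i0] it is [b], since the
   switches leaving [G i0] remove [{u, b}]. *)
have ex j : exists z, if j == i0 then z = b else alt_diff (G i0) (G j) u b v z.
  case: eqVneq => [_|nj0]; first by exists b.
  case: (eqVneq i1 j) => [<-|n1j]; first by exists d.
  case: (eqVneq i2 j) => [<-|n2j]; first by exists d'.
  rewrite eq_sym in nj0; have [? [? [? [? D]]]] := G_switch nj0.
  have [[? ?] [? ?]] := clique_common i10 nj0 n1j.
  have [[? ?] [? ?]] := clique_common i20 nj0 n2j.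
  by apply: (alt_diff_extend D1 D2 D ndd); eassumption.
have [w wP] := fin_all_exists ex; exists u, v, w => i j ij.
move: (wP i) (wP j).
case: (eqVneq i i0) => [E|ni]; case: (eqVneq j i0) => [E'|nj].
- by rewrite E E' eqxx in ij.
- by rewrite E => ->.
- by rewrite E' => Di ->; apply: alt_diff_sym.
move=> Di Dj; apply: (alt_diff_base Di Dj); apply/eqP=> E.
have [? [? [? [? Dij]]]] := G_switch ij; case/eqP: (alt_diff_neq Dij).
by rewrite (alt_diff_switch Di) (alt_diff_switch Dj) E.
Qed.

End Family.
End AlternatingDifference.

(** * Construction of the dial from the poles *)

Theorem theorem3 (m : nat) (d : m.-tuple nat) (n : nat)
    (R : 'I_n -> realization d) :
  4 <= n ->
  injective R ->
  clique (@realization_graph m d) [set R i | i : 'I_n] ->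
  exists (W : {set 'I_m}) (P : {set {set 'I_m}}),
    dial [set R i | i : 'I_n] W P /\
    forall i j : 'I_n, i != j ->
      exists u v w x : 'I_m,
        dial_alt4 W P (R i) u v w x /\ edges (R j) = switch (R i) u v w x.
Proof.
move=> n_ge4 R_inj R_clique.
have R_switch i j : i != j -> exists a b c e, alt_diff (R i) (R j) a b c e.
  move=> ij; apply: switch_to_alt_diff.
  by apply: R_clique; rewrite ?imset_f // (inj_eq R_inj).
have [u [v [w wP]]] := clique_poles n_ge4 R_switch.
set S := [set R i | i : 'I_n]; set P := varying_pairs S.
have other (i : 'I_n) : exists j, j != i.
  by have [j /andP[]] := exists_fourth n_ge4 i i i; exists j.
have uniqP i j : i != j -> uniq [:: u; w i; v; w j] by case/wP.
have uv : u != v.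
  have [j ji] := other (Ordinal (leq_trans (isT : 0 < 4) n_ge4)).
  by move: (uniqP _ _ ji); rewrite uniq4 => /and5P[].
have uw i : u != w i.
  by have [j ji] := other i; move: (uniqP _ _ ji); rewrite uniq4 => /and5P[].
have vw i : v != w i.
  have [j ji] := other i; move: (uniqP _ _ ji); rewrite uniq4.
  by case/and5P=> _ _ _ _ /andP[].
(* The switch from [R i] to any other member removes [{u, w i}]. *)
have uE i j : ([set u; w i] \in edges (R j)) = (i == j).
  case: (eqVneq i j) => [<-|ij].
    have [k ki] := other i; rewrite eq_sym in ki; have [_ A _] := wP _ _ ki.
    by have := set21 [set u; w i] [set v; w k]; rewrite -A inE => /andP[].
  have [_ A _] := wP _ _ ij; have := set21 [set u; w i] [set v; w j].
  by rewrite -A inE => /andP[/negbTE].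
(* The switch from any other member to [R i] removes [{v, w i}]. *)
have vE i j : ([set v; w i] \in edges (R j)) = (i != j).
  case: (eqVneq i j) => [<-|ij] /=.
    have [k ki] := other i; have [_ A _] := wP _ _ ki.
    by have := set22 [set u; w k] [set v; w i]; rewrite -A inE => /andP[/negbTE].
  rewrite eq_sym in ij; have [_ A _] := wP _ _ ij.
  by have := set22 [set u; w j] [set v; w i]; rewrite -A inE => /andP[].
pose X := [set w i | i : 'I_n].
have starX (t : 'I_m) i : [set t; w i] \in [set [set t; y] | y in X].
  by apply/imsetP; exists (w i); rewrite ?imset_f.
have PE : P = [set [set u; y] | y in X] :|: [set [set v; y] | y in X].
  apply/setP=> e; rewrite in_setU !inE; apply/idP/idP.
    case/and3P=> _ /exists_inP[_ /imsetP[i _ ->] ei] /exists_inP[_ /imsetP[j _ ->] ej].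
    (* A varying pair lies in some [R i] and not in some [R j], so it is one of the two pairs
       removed between them. *)
    have ij : i != j by apply: contraNneq ej => <-.
    have [_ A _] := wP _ _ ij.
    have : e \in edges (R i) :\: edges (R j) by rewrite inE ej.
    rewrite A => /set2P[]->; by rewrite starX ?orbT.
  case/orP=> /imsetP[_ /imsetP[i _ ->] ->]; have [j ji] := other i.
    rewrite cards2_neq //=; apply/andP; split; apply/exists_inP.
      by exists (R i); rewrite ?imset_f // uE.
    by exists (R j); rewrite ?imset_f // uE eq_sym.
  rewrite cards2_neq //=; apply/andP; split; apply/exists_inP.
    by exists (R j); rewrite ?imset_f // vE eq_sym.
  by exists (R i); rewrite ?imset_f // vE eqxx.
have uP i : [set u; w i] \in P by rewrite PE inE starX.
have vP i : [set v; w i] \in P by rewrite PE inE starX orbT.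
have i0 : 'I_n := Ordinal (leq_trans (isT : 0 < 4) n_ge4).
have uW : u \in cover P by apply/bigcupP; exists [set u; w i0]; rewrite ?set21.
have vW : v \in cover P by apply/bigcupP; exists [set v; w i0]; rewrite ?set21.
have wW i : w i \in cover P.
  by apply/bigcupP; exists [set u; w i]; rewrite ?set22.
have WX : cover P :\: [set u; v] = X.
  apply/setP=> y; rewrite in_setD in_set2; apply/andP/imsetP => [[nuv]|[i _ ->]].
    case/bigcupP=> e; rewrite PE => /setUP[] /imsetP[_ /imsetP[i _ ->] ->];
      by case/set2P=> E; [rewrite E eqxx ?orbT in nuv | exists i].
  by rewrite wW negb_or ![w i == _]eq_sym uw vw.
exists (cover P), P; split; last first.
  move=> i j ij; exists u, (w i), v, (w j); have D := wP _ _ ij; split.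
    rewrite /dial_alt4; apply/and5P; split.
    - by case: D.
    - by apply/subsetP=> x; rewrite !inE -!orbA => /or4P[] /eqP->.
    - by rewrite inE uP uE eqxx.
    - by rewrite inE vP vE eq_sym.
    by rewrite [[set w i; v]]setUC !in_setD uP vP uE vE eqxx eq_sym ij.
  exact: alt_diff_switch.
split=> //; exists u, v; rewrite /= WX; split=> //.
move=> _ /imsetP[i _ ->]; exists (w i); rewrite /adjacent; split.
- exact: imset_f.
- by rewrite uE.
- move=> y /setD1P[ny /imsetP[j _ E]]; rewrite E uE.
  by apply: contraNneq ny => <-; rewrite E.
- by rewrite vE eqxx.
- move=> y /setD1P[ny /imsetP[j _ E]]; rewrite E vE.
  by apply: contraNneq ny => <-; rewrite E.
Qed.
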